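(* Let $m\ge 0$ be an integer, $b_1,b_2\in\mathbb C$, and let $z=\frac12\left(e^x+e^{-x}-2\right)^{1/2}$, $w=\frac12\left(e^x+e^{-x}+2\right)^{1/2}$ be regarded as functions of the variable $x$. Then the Umemura polynomials $U_m(b_1,b_2)$ satisfy $$(b_1^2-b_2^2)\,U_m(b_1-1,b_2)\,U_m(b_1+1,b_2)=(b_1^2-b_2^2)\,U_m(b_1,b_2)^2+2z^2\,D_x^2\,U_m(b_1,b_2)\circ U_m(b_1,b_2).$$
   Context: Let $[0;m]=\{2,4,\ldots,2m\}$. For a finite set $I$ of positive integers, $|I|$ denotes the SUM of its elements. For parameters $a,b$ put $\bar a_k=a+(k-1)^2$, $\bar b_k=b+(k-1)^2$, $a_{2k}=\bar a_2\bar a_4\cdots\bar a_{2k}$, $b_{2k}=\bar b_2\bar b_4\cdots\bar b_{2k}$, $a_I=\prod_{i\in I}a_i$, $b_I=\prod_{i\in I}b_i$. Define $$U_{0,m}(z,w;a,b)=\sum_{I\subset[0;m]}\ \prod_{i\in I,\ j\in[0;m]\setminus I}\left|\frac{i+j}{i-j}\right|\,(-1)^{|I|/2}\,a_I\,b_{[0;m]\setminus I}\,z^{|I|}\,w^{|[0;m]\setminus I|}.$$ The notation $U_m(b_1,b_2)$ means $U_{0,m}(z,w;-4b_1^2,-4b_2^2)$ (this is the $(m+1)$-st Umemura polynomial associated with Painlevé VI). For functions $f,g$ of $x$, with $'=d/dx$, the second Hirota derivative is $D_x^2 f\circ g=f''g-2f'g'+fg''$. The variable $x$ may be taken real positive,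 with positive square roots; then $w^2-z^2=1$. *)

(* Defs.v *)
From HB Require Import structures.
From mathcomp Require Import all_boot all_order all_algebra.
From mathcomp Require Import all_classical all_reals all_analysis.
From mathcomp Require Import complex.

Set Implicit Arguments.
Unset Strict Implicit.
Unset Printing Implicit Defensive.

Import Order.TTheory GRing.Theory Num.Theory.
Import numFieldNormedType.Exports.

Local Open Scope ring_scope.
Local Open Scope complex_scope.

(* [Rcomplex R] is the alias of [R[i]] carrying the structure of a normed
   real vector space (with the modulus as norm).  We add the topology of the
   norm, so that a function R -> R[i] of a real variable has a derivative. *)

Lemma Rcomplex_normZ (R : rcfType) (k : R) (x : Rcomplex R) :
  `|k *: x| = `|k| * `|x|.
Proof.
case: x => a b; rewrite /Num.norm /= !exprMn -mulrDr sqrtrM ?sqr_ge0 //.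
by rewrite sqrtr_sqr.
Qed.

HB.instance Definition _ (R : rcfType) :=
  PseudoMetric.copy (Rcomplex R) (pseudoMetric_normed (Rcomplex R)).

HB.instance Definition _ (R : rcfType) := isPointed.Build (Rcomplex R) 0.

HB.instance Definition _ (R : rcfType) :=
  NormedZmod_PseudoMetric_eq.Build R (Rcomplex R) erefl.

HB.instance Definition _ (R : rcfType) :=
  PseudoMetricNormedZmod_Lmodule_isNormedModule.Build R (Rcomplex R)
    (@Rcomplex_normZ R).

Definition cderive (R : realType) (n : nat) (f : R -> R[i]) : R -> R[i] :=
  derive1n n (f : R -> Rcomplex R).

Definition hirota2 (R : realType) (f g : R -> R[i]) (x : R) : R[i] :=
  cderive 2 f x * g x - 2 * (cderive 1 f x * cderive 1 g x)
  + f x * cderive 2 g x.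

(* The index set [0;m] = {2, 4, ..., 2m}, as a set of ordinals below 2m+1;
   the coercion from ordinals to nat gives back the integer. *)
Definition evens (m : nat) : {set 'I_(m.*2.+1)} :=
  [set i : 'I_(m.*2.+1) | (0 < i)%N && ~~ odd i].

(* The sum (not the cardinal) of the elements of I. *)
Definition sumset (n : nat) (I : {set 'I_n}) : nat := (\sum_(i in I) i)%N.

Definition shifted (K : pzRingType) (c : K) (k : nat) : K :=
  c + (k%:R - 1) ^+ 2.

(* For even n = 2k, the product of [shifted c j] over j = 2, 4, ..., 2k. *)
Definition evenprod (K : pzRingType) (c : K) (n : nat) : K :=
  \prod_(1 <= l < n./2.+1) shifted c l.*2.

Definition evenprodset (K : comPzRingType) (c : K) (n : nat) (I : {set 'I_n}) :
  K := \prod_(i in I) evenprod c i.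

Definition U0 (K : numFieldType) (m : nat) (z w a b : K) : K :=
  \sum_(I : {set 'I_(m.*2.+1)} | I \subset evens m)
    (\prod_(i in I) \prod_(j in evens m :\: I)
        `|(i%:R + j%:R) / (i%:R - j%:R)|)
    * (-1) ^+ (sumset I)./2
    * evenprodset a I * evenprodset b (evens m :\: I)
    * z ^+ sumset I * w ^+ sumset (evens m :\: I).

Definition zfun (R : realType) (x : R) : R :=
  2^-1 * Num.sqrt (expR x + expR (- x) - 2).

Definition wfun (R : realType) (x : R) : R :=
  2^-1 * Num.sqrt (expR x + expR (- x) + 2).

(* The Umemura polynomial U_m(b1,b2), as a function of x. *)
Definition umemura (R : realType) (m : nat) (b1 b2 : R[i]) (x : R) : R[i] :=
  U0 m (zfun x)%:C (wfun x)%:C (- 4 * b1 ^+ 2) (- 4 * b2 ^+ 2).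

(* Main.v *)
Require Import Defs.
From mathcomp Require Import all_boot all_order all_algebra.
From mathcomp Require Import all_classical all_reals all_analysis.
From mathcomp Require Import complex.
From mathcomp Require Import ring lra zify.
(* The lemmas on finite sets take precedence over those on classical sets. *)
From mathcomp Require Import fintype finset.

Set Implicit Arguments.
Unset Strict Implicit.
Unset Printing Implicit Defensive.

Import Order.TTheory GRing.Theory Num.Theory.
Import numFieldNormedType.Exports.

Local Open Scope ring_scope.
Local Open Scope complex_scope.

(** Write [S] for [{2, 4, ..., 2m}], [c_I] for the summand of [U0] at the subset
    [I], and [e_I(i) = i] or [-i] according to whether [i] is in [I].  The proof
    studies the polynomial in an auxiliary variable [t]
      [F(t) = \sum_I c_I \prod_(i in S) (t + e_I(i))],
    which, up to the factor [\prod_(i in S) (t - i)], is [U0] times the Baker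
    function of a KdV soliton tau function.  Four facts carry it.

    1. For [i] in [S], only subsets containing [i] contribute to [F(i)] and only
       those avoiding [i] contribute to [F(-i)]; adding [i] matches them term by
       term, so that [F(i) = a_i z^i H_i] and [F(-i) = b_i w^i H_i] with the same
       [H_i] ([Ugen_exchange]).  The coupling factors [|(i+j)/(i-j)|] and the sign
       are exactly what this requires.

    2. The quantity
       [w^2 ((t-1)^2 + b) F(t) F(2-t) - z^2 ((t-1)^2 + a) F(-t) F(t-2)]
       therefore vanishes for [t] in [S], by fact 1 at [i] and [i - 2] and the
       recursion of [a_i] and [b_i] ([bilinear_vanish]).  It is even in
       [v = t - 1] and has degree [2m + 2], so these [2m] zeros leave two unknown
       coefficients, which are read off the expansion of [F] at infinity.  They
       are quadratic in the moments [M_k = \sum_I c_I (\sum_i e_I(i))^k]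
       ([bilin_eq]).

    3. Let [a = -4 b1^2] and [t = 1 + 2 b1].  Then the second term of the bilinear
       quantity vanishes.  Raising [b1] by [1] multiplies [a_i] by
       [(t + i) / (t - i)], and lowering it does the same with [2 - t] for [t], so
       that [F(t)] and [F(2 - t)] are multiples of the polynomials at [b1 + 1] and
       [b1 - 1] ([Ugen_raise], [Ugen_lower]).  This
       expresses [U_m(b1-1) U_m(b1+1)] by the moments, when [b1] avoids finitely
       many values; both sides being polynomials in [b1], the relation holds for
       every [b1] ([toda_moments]).

    4. As [z = sinh(x/2)] and [w = cosh(x/2)], the derivative multiplies each [c_I]
       by an affine function of [\sum_i e_I(i)].  So the first two derivatives of
       [U_m] are combinations of [M_0], [M_1] and [M_2], and the relation of fact 3
       becomes the Toda equation of the theorem. *)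

(** * Products of polynomials close to one *)

Section PolyProducts.
Variable K : comNzRingType.

Lemma size_1addcXn (c : K) n : (size (1 + c *: 'X^n)%R <= n.+1)%N.
Proof.
rewrite (leq_trans (size_polyD _ _)) // geq_max size_poly1 /=.
by rewrite (leq_trans (size_scale_leq _ _)) // size_polyXn.
Qed.

Lemma size_mul_bound (p q : {poly K}) j k :
  (size p <= j.+1)%N -> (size q <= k.+1)%N -> (size (p * q)%R <= (j + k).+1)%N.
Proof.
move=> sp sq; apply: leq_trans (size_polyMleq _ _) _.
by rewrite -subn1 leq_subLR (leq_trans (leq_add sp sq)) // addSn addnS.
Qed.

Lemma size_prod_bound (T : finType) (S : {set T}) (F : T -> {poly K}) d :
  (forall i, (size (F i) <= d.+1)%N) ->
  (size (\prod_(i in S) F i)%R <= (#|S| * d).+1)%N.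
Proof.
move=> sF; rewrite -sum_nat_const.
elim/big_rec2: _ => [|i k q _ sq]; first by rewrite size_poly1.
exact: size_mul_bound.
Qed.

Lemma coef_1addcX2_mul (c : K) (p : {poly K}) k :
  ((1 + c *: 'X^2) * p)`_k = p`_k + c * (if (k < 2)%N then 0 else p`_(k - 2)).
Proof. by rewrite mulrDl mul1r -scalerAl coefD coefZ coefXnM. Qed.

Lemma prod_1addcX_coefs (T : finType) (S : {set T}) (c : T -> K) :
  let P := \prod_(i in S) (1 + c i *: 'X) : {poly K} in
  [/\ P`_0 = 1, P`_1 = \sum_(i in S) c i &
      2 * P`_2 = (\sum_(i in S) c i) ^+ 2 - \sum_(i in S) c i ^+ 2].
Proof.
move=> P; rewrite {}/P.
elim/big_rec3: _ => [|i s2 s1 p iS [p0 p1 p2]].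
  by rewrite !coef1; split=> //=; ring.
have E q n : ((1 + c i *: 'X) * q)`_n.+1 = q`_n.+1 + c i * q`_n :> K.
  by rewrite mulrDl mul1r -scalerAl coefD coefZ coefXM.
split; rewrite ?E.
- by rewrite coef0M coefD coefZ coefX coef1 p0 /=; ring.
- by rewrite p0 p1; ring.
- by rewrite mulrDr p2 p1; ring.
Qed.

Lemma prod_1addcX2_coefs (T : finType) (S : {set T}) (c : T -> K) :
  let P := \prod_(i in S) (1 + c i *: 'X^2) : {poly K} in
  [/\ P`_0 = 1, P`_1 = 0 & P`_2 = \sum_(i in S) c i].
Proof.
move=> P; rewrite {}/P; elim/big_rec2: _ => [|i s q iS [q0 q1 q2]].
  by rewrite !coef1.
by rewrite !coef_1addcX2_mul /= q0 q1 q2; split; ring.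
Qed.

End PolyProducts.

(** * Interpolation of an even polynomial *)

Section EvenInterpolation.
Variables (K : numFieldType) (T : finType) (S : {set T}) (y : T -> K).
Hypothesis ypos : {in S, forall i, 0 < y i}.
Hypothesis yinj : {in S &, injective y}.

(** The polynomial [p] is a polynomial in [v] of degree [2#|S| + 2] written in the
    variable [1/v], with roots [v = y i] and [v = - y i].  In that variable the
    three leading coefficients have index 0, 1 and 2, whatever [#|S|].  With [W]
    the product of the [1 - (y i)^2 X^2], the difference of [p] and
    [W (p_0 + e X^2)] is divisible by [X^3] for a suitable [e] and has [2#|S|]
    further roots, which exceeds its degree. *)
Lemma even_interpolation (p : {poly K}) (v : K) :
  (size p <= #|S|.*2.+3)%N -> p`_1 = 0 ->
  {in S, forall i, root p (y i)^-1 /\ root p (- (y i)^-1)} -> v != 0 ->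
  v ^+ #|S|.*2.+2 * p.[v^-1] =
  (p`_0 * v ^+ 2 + p`_2 + p`_0 * \sum_(i in S) y i ^+ 2)
  * \prod_(i in S) (v ^+ 2 - y i ^+ 2).
Proof.
move=> sp p1 rp v0.
pose W := \prod_(i in S) (1 + (- y i ^+ 2) *: 'X^2) : {poly K}.
have WE t : W.[t] = \prod_(i in S) (1 - y i ^+ 2 * t ^+ 2).
  rewrite /W horner_prod; apply: eq_bigr => i _.
  by rewrite hornerD hornerZ hornerXn hornerC mulNr.
have sW : (size W <= #|S|.*2.+1)%N.
  by rewrite -muln2; apply: size_prod_bound => i; exact: size_1addcXn.
have [W0 W1] := prod_1addcX2_coefs S (fun i => - y i ^+ 2).
rewrite sumrN -/W in W0 W1 * => W2.
pose e := p`_2 + p`_0 * \sum_(i in S) y i ^+ 2.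
pose D := p - W * ((p`_0)%:P + e *: 'X^2).
have c n : (n < 3)%N -> D`_n = 0.
  rewrite /D coefB mulrDr -scalerAr coefD coefMC coefZ coefMXn.
  case: n => [|[|[|n]]] //= _; rewrite ?p1 ?W0 ?W1 ?W2 /e; ring.
have DE : D = drop_poly 3 D * 'X^3.
  rewrite -[LHS](poly_take_drop 3) [X in X + _](_ : _ = 0) ?add0r //.
  by apply/polyP => n; rewrite coef_take_poly coef0; case: ifP => // /c.
have D0 : D = 0.
  rewrite DE; suff -> : drop_poly 3 D = 0 by rewrite mul0r.
  have rtD i s : i \in S -> s = (y i)^-1 \/ s = - (y i)^-1 ->
      root (drop_poly 3 D) s.
    move=> iS hs; have yi0 : y i != 0 by rewrite gt_eqF // ypos.
    have s0 : s != 0 by case: hs => ->; rewrite ?oppr_eq0 invr_eq0.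
    have : root D s.
      rewrite /root /D hornerD hornerN hornerM WE (bigD1 i) //=.
      have -> : y i ^+ 2 * s ^+ 2 = 1 by case: hs => ->; field.
      rewrite subrr !mul0r subr0.
      by have [r1 r2] := rp i iS; case: hs => ->.
    rewrite {1}DE rootM => /orP[] //.
    by rewrite /root !hornerE expf_eq0 (negPf s0) andbF.
  pose rs := [seq (y i)^-1 | i <- enum S] ++ [seq - (y i)^-1 | i <- enum S].
  apply: (@roots_geq_poly_eq0 _ _ rs).
  - rewrite all_cat; apply/andP; split; apply/allP => s /mapP[k];
      rewrite mem_enum => kS ->; apply: (rtD k) => //; by [left|right].
  - rewrite cat_uniq !map_inj_in_uniq ?enum_uniq ?andbT /=.
    + apply/hasPn => s /mapP[k]; rewrite mem_enum => kS ->.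
      apply/negP => /mapP[j]; rewrite mem_enum => jS h.
      have : 0 < (y k)^-1 + (y j)^-1 by rewrite addr_gt0 // invr_gt0 ypos.
      by rewrite -h subrr ltxx.
    + by move=> i j; rewrite !mem_enum => iS jS /oppr_inj/invr_inj; apply: yinj.
    + by move=> i j; rewrite !mem_enum => iS jS /invr_inj; apply: yinj.
  - rewrite size_cat !size_map -cardE addnn size_drop_poly leq_subLR.
    rewrite /D (leq_trans (size_polyD _ _)) // geq_max sp size_polyN /=.
    rewrite addSn addnC; apply: size_mul_bound sW _.
    rewrite (leq_trans (size_polyD _ _)) // geq_max.
    rewrite (leq_trans (size_polyC_leq1 _)) //=.
    by rewrite (leq_trans (size_scale_leq _ _)) // size_polyXn.
have -> : p.[v^-1] = (W * ((p`_0)%:P + e *: 'X^2)).[v^-1].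
  by congr (_.[_]); apply/eqP; rewrite -subr_eq0 -/D D0.
have -> : \prod_(i in S) (v ^+ 2 - y i ^+ 2) = v ^+ #|S|.*2 * W.[v^-1].
  rewrite WE -mul2n exprM -prodr_const -big_split /=; apply: eq_bigr => i _.
  by field.
by rewrite hornerM hornerD hornerC hornerZ hornerXn exprVn /e 2!exprS; field.
Qed.

End EvenInterpolation.

(** * The exchange relation *)

Section Exchange.
Variable K : numFieldType.

Definition pairweight (i j : nat) : K := `|(i%:R + j%:R) / (i%:R - j%:R)|.

Lemma pairweight_mul i j : i != j ->
  pairweight i j * (i%:R - j%:R) = (-1) ^+ (i < j)%N * (i%:R + j%:R).
Proof.
move=> ij; rewrite /pairweight normrM normfV ger0_norm ?addr_ge0 ?ler0n //.
have n0 : i%:R - j%:R != 0 :> K by rewrite subr_eq0 eqr_nat.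
case: ltnP => [lij|lij]; rewrite ?expr1 ?expr0.
  rewrite ltr0_norm ?subr_lt0 ?ltr_nat //; field.
  by move: n0; rewrite -opprB oppr_eq0.
by rewrite ger0_norm ?subr_ge0 ?ler_nat //; field.
Qed.

Variable m : nat.
Local Notation S := (evens m).
Implicit Types I : {set 'I_(m.*2.+1)}.

Lemma in_evens (i : 'I_(m.*2.+1)) : (i \in S) = (0 < i)%N && ~~ odd i.
Proof. by rewrite inE. Qed.

Lemma big_evens (R : Type) (idx : R) (op : Monoid.com_law idx) (F : nat -> R) :
  \big[op/idx]_(i in S) F i = \big[op/idx]_(k < m) F k.+1.*2.
Proof.
transitivity (\big[op/idx]_(0 <= i < m.*2.+1 | (0 < i)%N && ~~ odd i) F i).
  by rewrite big_mkord; apply: eq_bigl => i; rewrite inE.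
elim: m => [|n IH].
  by rewrite big_mkcond big_nat1 big_ord0.
rewrite big_ord_recr /= -IH doubleS.
rewrite big_mkcond big_nat_recr //= big_nat_recr //= -big_mkcond /=.
by rewrite odd_double /= Monoid.mulm1.
Qed.

(** This counts the [i0/2 - 1] elements of [S] below [i0]; it is what the sign
    [(-1)^(i/2)] in the definition of the Umemura polynomials compensates. *)
Lemma prod_sign_evens (i0 : 'I_(m.*2.+1)) : i0 \in S ->
  \prod_(k in S :\ i0) (-1) ^+ (k < i0)%N = - (-1) ^+ (i0./2) :> K.
Proof.
move=> iS.
transitivity (\prod_(k in S) (-1 : K) ^+ (k < i0)%N).
  by rewrite [RHS](big_setD1 i0) //= ltnn expr0 mul1r.
rewrite (big_evens _ (fun k => (-1 : K) ^+ (k < i0)%N)).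
move: iS; rewrite in_evens => /andP[i00 ie].
have [j ij] : exists j, i0 = j.+1.*2 :> nat.
  exists i0./2.-1; move: (odd_double_half i0) i00; rewrite (negPf ie).
  by case: (i0./2) => [|n] /=; lia.
have jm : (j < m)%N by have := ltn_ord i0; rewrite ij; lia.
rewrite ij (eq_bigr (fun k : 'I_m => (-1 : K) ^+ (k < j)%N)); last first.
  by move=> k _; rewrite ltn_double ltnS.
rewrite doubleK exprS mulN1r opprK.
rewrite (eq_bigr (fun k : 'I_m => if (k < j)%N then -1 else 1)); last first.
  by move=> k _; case: ifP.
rewrite -big_mkcond -(big_ord_widen m (fun=> -1)) ?prodr_const ?card_ord //.
exact: ltnW.
Qed.

Definition signedval I (i : 'I_(m.*2.+1)) : K :=
  if i \in I then i%:R else - i%:R.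

Definition Uterm (z w a b : K) I : K :=
  (\prod_(i in I) \prod_(j in S :\: I) pairweight i j)
    * (-1) ^+ (sumset I)./2
    * evenprodset a I * evenprodset b (S :\: I)
    * z ^+ sumset I * w ^+ sumset (S :\: I).

Lemma U0E z w a b :
  U0 m z w a b = \sum_(I : {set 'I_(m.*2.+1)} | I \subset S) Uterm z w a b I.
Proof. by []. Qed.

(** The polynomial [F(t)] of the introduction.  Its leading coefficient is
    [U0 m z w a b]. *)
Definition Ugen (z w a b t : K) : K :=
  \sum_(I : {set 'I_(m.*2.+1)} | I \subset S)
    Uterm z w a b I * \prod_(i in S) (t + signedval I i).

Lemma evenprodsetU1 (c : K) n (I : {set 'I_n}) i : i \notin I ->
  evenprodset c (i |: I) = evenprod c i * evenprodset c I.
Proof. by move=> iI; rewrite /evenprodset big_setU1. Qed.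

Lemma sumsetU1 n (I : {set 'I_n}) i : i \notin I ->
  sumset (i |: I) = (i + sumset I)%N.
Proof. by move=> iI; rewrite /sumset big_setU1. Qed.

Lemma odd_sumset I : I \subset S -> odd (sumset I) = false.
Proof.
move=> /subsetP sIS; rewrite /sumset; elim/big_rec: _ => [//|i n /sIS].
by rewrite in_evens oddD => /andP[_ /negPf->] ->.
Qed.

Lemma prod_signedval I i0 (t : K) : I \subset S :\ i0 -> i0 \in S ->
  \prod_(i in S) (t + signedval I i) =
  (t - i0%:R) * (\prod_(i in I) (t + i%:R))
  * \prod_(j in S :\ i0 :\: I) (t - j%:R).
Proof.
move=> sI i0S; rewrite (big_setD1 i0) //= -mulrA; congr (_ * _).
  by rewrite /signedval; case: ifP => // /(subsetP sI); rewrite !inE eqxx.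
rewrite (big_setID I) /= (setIidPr sI); congr (_ * _).
  by apply: eq_bigr => i iI; rewrite /signedval iI.
by apply: eq_bigr => i; rewrite /signedval inE => /andP[/negPf->].
Qed.

Lemma prod_signedvalU1 I i0 (t : K) : I \subset S :\ i0 -> i0 \in S ->
  \prod_(i in S) (t + signedval (i0 |: I) i) =
  (t + i0%:R) * (\prod_(i in I) (t + i%:R))
  * \prod_(j in S :\ i0 :\: I) (t - j%:R).
Proof.
move=> sI i0S; rewrite (big_setD1 i0) //= -mulrA; congr (_ * _).
  by rewrite /signedval setU11.
rewrite (big_setID I) /= (setIidPr sI); congr (_ * _).
  by apply: eq_bigr => i iI; rewrite /signedval inE iI orbT.
by apply: eq_bigr => i; rewrite /signedval !inE => /andP[/negPf-> /andP[/negPf->]].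
Qed.

Section ExchangeTerm.
Variables (z w a b : K) (i0 : 'I_(m.*2.+1)) (I : {set 'I_(m.*2.+1)}).
Hypothesis i0S : i0 \in S.
Hypothesis sI : I \subset S :\ i0.
Let J := S :\ i0 :\: I.

(** The part common to the summand of [Ugen] at [i0] for the subset [i0 |: I] and
    to its summand at [- i0] for the subset [I]. *)
Definition exchange_term : K :=
  (\prod_(i in I) \prod_(j in J) pairweight i j) * (-1) ^+ (sumset I)./2
  * evenprodset a I * evenprodset b J * z ^+ sumset I * w ^+ sumset J
  * (- (i0%:R + i0%:R))
  * (\prod_(i in I) ((-1) ^+ (i < i0)%N * (i%:R + i0%:R)))
  * \prod_(j in J) (- i0%:R - j%:R).

Let i0I : i0 \notin I.
Proof. by apply/negP => /(subsetP sI); rewrite !inE eqxx. Qed.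
Let i0J : i0 \notin J.
Proof. by rewrite !inE eqxx andbF. Qed.

(** The denominators of the couplings of [i0] with [I] cancel against the factors
    [- i0 + i] of [Ugen] at [- i0]. *)
Lemma exchange_out :
  Uterm z w a b I * \prod_(i in S) (- i0%:R + signedval I i) =
  evenprod b i0 * w ^+ i0 * exchange_term.
Proof.
rewrite (prod_signedval _ sI i0S) -/J /Uterm.
have -> : S :\: I = i0 |: J.
  apply/setP => i; rewrite !inE; case: eqVneq => [->|_] /=; last by [].
  by rewrite i0I; move: i0S; rewrite inE.
rewrite evenprodsetU1 // sumsetU1 // exprD.
rewrite (eq_bigr (fun i : 'I__ =>
  pairweight i i0 * \prod_(j in J) pairweight i j)); last first.
  by move=> i _; rewrite big_setU1.
have -> : \prod_(i in I) (- i0%:R + i%:R : K) = \prod_(i in I) (i%:R - i0%:R).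
  by apply: eq_bigr => i _; rewrite addrC.
rewrite /exchange_term.
have -> : \prod_(i in I) ((-1) ^+ (i < i0)%N * (i%:R + i0%:R) : K) =
  (\prod_(i in I) pairweight i i0) * \prod_(i in I) (i%:R - i0%:R).
  rewrite -big_split /=; apply: eq_bigr => i iI.
  rewrite pairweight_mul //.
  by apply: contra i0I => /eqP/ord_inj <-.
by rewrite big_split /=; ring.
Qed.

(** Here the couplings of [i0] with [J] cancel against the factors [i0 - j].  The
    signs left over lie on [J] instead of [I], and [prod_sign_evens] moves them. *)
Lemma exchange_in :
  Uterm z w a b (i0 |: I) * \prod_(i in S) (i0%:R + signedval (i0 |: I) i) =
  evenprod a i0 * z ^+ i0 * exchange_term.
Proof.
rewrite (prod_signedvalU1 _ sI i0S) -/J /Uterm.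
have -> : S :\: (i0 |: I) = J.
  by apply/setP => i; rewrite !inE negb_or; case: (i == i0); case: (i \in I).
have oI : odd (sumset I) = false.
  by apply: odd_sumset; apply: subset_trans sI (subsetDl _ _).
rewrite evenprodsetU1 // sumsetU1 // halfD oI andbF add0n !exprD big_setU1 //=.
have -> : \prod_(i in I) (i0%:R + i%:R : K) = \prod_(i in I) (i%:R + i0%:R).
  by apply: eq_bigr => i _; rewrite addrC.
rewrite /exchange_term.
have EJ : (\prod_(j in J) pairweight i0 j) * \prod_(j in J) (i0%:R - j%:R) =
  (\prod_(j in J) (-1) ^+ (j < i0)%N) * \prod_(j in J) (- i0%:R - j%:R : K).
  rewrite -!big_split /=; apply: eq_bigr => j jJ.
  have ne : i0 != j :> nat by apply: contra i0J => /eqP/ord_inj ->.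
  rewrite pairweight_mul //.
  case: ltngtP ne => // _ _; rewrite ?expr0 ?expr1; ring.
have := prod_sign_evens i0S; rewrite (big_setID I) /= (setIidPr sI) -/J => Es.
have EI : \prod_(i in I) ((-1) ^+ (i < i0)%N * (i%:R + i0%:R)) =
  - (-1) ^+ i0./2 * (\prod_(j in J) (-1) ^+ (j < i0)%N)
  * \prod_(i in I) (i%:R + i0%:R : K).
  rewrite big_split /= -Es; congr (_ * _).
  rewrite -[LHS]mulr1 -mulrA; congr (_ * _); rewrite -big_split big1 //= => j _.
  by rewrite -signr_addb addbb.
rewrite EI.
transitivity
  ((\prod_(j in J) pairweight i0 j * \prod_(j in J) (i0%:R - j%:R)) *
   ((\prod_(i in I) \prod_(j in J) pairweight i j)
    * ((-1) ^+ i0./2 * (-1) ^+ (sumset I)./2)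
    * (evenprod a i0 * evenprodset a I) * evenprodset b J
    * (z ^+ i0 * z ^+ sumset I) * w ^+ sumset J
    * ((i0%:R + i0%:R) * \prod_(i in I) (i%:R + i0%:R)))); first by ring.
by rewrite EJ; ring.
Qed.

End ExchangeTerm.

(** At [i0] the summands with [i0] outside [I] vanish, at [- i0] those with [i0] in
    [I]; the remaining ones are matched by adding [i0].  Stating the relation with
    a common factor, rather than as an equality of ratios, keeps it usable when
    [a_i0] or [b_i0] vanishes. *)
Lemma Ugen_exchange (z w a b : K) (i0 : 'I_(m.*2.+1)) : i0 \in S ->
  exists H, Ugen z w a b i0%:R = evenprod a i0 * z ^+ i0 * H /\
            Ugen z w a b (- i0%:R) = evenprod b i0 * w ^+ i0 * H.
Proof.
move=> i0S.
exists (\sum_(I : {set 'I_(m.*2.+1)} | I \subset S :\ i0)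
          exchange_term z w a b i0 I).
split; rewrite big_distrr /=.
  transitivity (\sum_(I : {set 'I_(m.*2.+1)} | (I \subset S) && (i0 \in I))
     Uterm z w a b I * \prod_(i in S) (i0%:R + signedval I i)).
    rewrite big_mkcondr; apply: eq_bigr => I sI; case: ifP => // iI.
    by rewrite (big_setD1 i0) //= /signedval iI subrr mul0r mulr0.
  rewrite (reindex_onto (fun I : {set 'I_(m.*2.+1)} => i0 |: I)
             (fun I => I :\ i0)) /=; last first.
    by move=> I /andP[_ iI]; rewrite setD1K.
  apply: eq_big => [I|I /andP[/andP[sI _] /eqP e]].
    rewrite setU11 andbT subUset sub1set i0S subsetD1 /=; congr (_ && _).
    apply/eqP/idP => [<-|iI]; last by rewrite setU1K.
    by rewrite !inE eqxx.
  by rewrite exchange_in // -e setSD.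
transitivity (\sum_(I : {set 'I_(m.*2.+1)} | (I \subset S) && (i0 \notin I))
   Uterm z w a b I * \prod_(i in S) (- i0%:R + signedval I i)).
  rewrite big_mkcondr; apply: eq_bigr => I sI; case: ifP => // /negbFE iI.
  by rewrite (big_setD1 i0) //= /signedval iI addNr mul0r mulr0.
apply: eq_big => [I|I]; first by rewrite subsetD1.
by rewrite -subsetD1 => sI; rewrite exchange_out.
Qed.

Lemma evenprod0 (c : K) : evenprod c 0 = 1.
Proof. by rewrite /evenprod big_geq. Qed.

Lemma evenprodSS (c : K) n : ~~ odd n ->
  evenprod c n.+2 = evenprod c n * shifted c n.+2.
Proof.
move=> en; rewrite /evenprod /= big_nat_recr //=; congr (_ * shifted c _).
by rewrite doubleS -[in RHS](odd_double_half n) (negPf en).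
Qed.

(** Both sides are the same multiple of [H_i H_(i-2)], where [H] comes from
    [Ugen_exchange]; this is where the products over [2, 4, ..., i] enter. *)
Lemma bilinear_vanish (z w a b : K) (i : 'I_(m.*2.+1)) : i \in S ->
  w ^+ 2 * shifted b i * Ugen z w a b i%:R * Ugen z w a b (2 - i%:R) =
  z ^+ 2 * shifted a i * Ugen z w a b (- i%:R) * Ugen z w a b (i%:R - 2).
Proof.
move=> iS; have [H [-> ->]] := Ugen_exchange z w a b iS.
move: (iS); rewrite in_evens => /andP[i0 ei].
have [k [ik ek]] : exists k, i = k.+2 :> nat /\ ~~ odd k.
  move: (nat_of_ord i) i0 ei => [|[|k]] // _; rewrite /= negbK => ek.
  by exists k.
(* The exchange relation at [k = 0], outside [S], reads [F(0) = F(0)]. *)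
have [H' [h1 h2]] : exists H',
    Ugen z w a b k%:R = evenprod a k * z ^+ k * H' /\
    Ugen z w a b (- k%:R) = evenprod b k * w ^+ k * H'.
  case: (posnP k) => [->|k0].
    by exists (Ugen z w a b 0); rewrite oppr0 !evenprod0 !expr0 !mul1r.
  have km : (k < m.*2.+1)%N by have := ltn_ord i; rewrite ik; lia.
  by apply: (@Ugen_exchange z w a b (Ordinal km)); rewrite in_evens k0.
rewrite ik !evenprodSS //.
have -> : k.+2%:R - 2 = k%:R :> K by rewrite -natrB // subSS subn1.
have -> : 2 - k.+2%:R = - k%:R :> K by rewrite -addn2 natrD; ring.
by rewrite h1 h2 !exprS; ring.
Qed.

End Exchange.

(** * The bilinear identity *)

Section Bilinear.
Variables (K : numFieldType) (m : nat).
Local Notation S := (evens m).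
Local Notation n := #|evens m|.
Variables (z w a b : K).
Implicit Types I : {set 'I_(m.*2.+1)}.

Definition signedsum I : K := \sum_(i in S) signedval K I i.

Definition moment (k : nat) : K :=
  \sum_(I : {set 'I_(m.*2.+1)} | I \subset S) Uterm z w a b I * signedsum I ^+ k.

(** The polynomial [v -> Ugen (v + al)] (for [be = 1]), or [v -> Ugen (- (v + al))]
    up to sign (for [be = -1]), with its coefficients reversed. *)
Definition Urev (al be : K) : {poly K} :=
  \sum_(I : {set 'I_(m.*2.+1)} | I \subset S)
    Uterm z w a b I *: \prod_(i in S) (1 + (al + be * signedval K I i) *: 'X).

Lemma size_Urev al be : (size (Urev al be) <= n.+1)%N.
Proof.
apply: (leq_trans (size_sum _ _ _)); apply/bigmax_leqP => I _.
apply: leq_trans (size_scale_leq _ _) _.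
rewrite -[X in (_ <= X.+1)%N]muln1.
by apply: size_prod_bound => i; exact: (@size_1addcXn _ _ 1).
Qed.

Lemma horner_Urev al be v : v != 0 ->
  v ^+ n * (Urev al be).[v^-1] =
  \sum_(I : {set 'I_(m.*2.+1)} | I \subset S)
    Uterm z w a b I * \prod_(i in S) (v + al + be * signedval K I i).
Proof.
move=> v0; rewrite /Urev horner_sum big_distrr /=; apply: eq_bigr => I _.
rewrite hornerZ horner_prod mulrCA; congr (_ * _).
rewrite -prodr_const -big_split /=; apply: eq_bigr => i _.
by rewrite hornerD hornerZ hornerX hornerC; field.
Qed.

Lemma horner_Urev1 al v : v != 0 ->
  v ^+ n * (Urev al 1).[v^-1] = Ugen m z w a b (v + al).
Proof.
move=> v0; rewrite horner_Urev //; apply: eq_bigr => I _; congr (_ * _).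
by apply: eq_bigr => i _; rewrite mul1r.
Qed.

Lemma horner_UrevN1 al v : v != 0 ->
  v ^+ n * (Urev al (-1)).[v^-1] = (-1) ^+ n * Ugen m z w a b (- (v + al)).
Proof.
move=> v0; rewrite horner_Urev // big_distrr; apply: eq_bigr => I _.
rewrite [RHS]mulrCA; congr (_ * _).
by rewrite -prodr_const -big_split /=; apply: eq_bigr => i _; ring.
Qed.

(** The squares of the signed values do not depend on [I], so that the second
    elementary symmetric function of the roots, like the first, is a polynomial in
    [signedsum I]. *)
Lemma Urev_coefs al be : al ^+ 2 = 1 -> be ^+ 2 = 1 ->
  [/\ (Urev al be)`_0 = moment 0,
      (Urev al be)`_1 = al * n%:R * moment 0 + be * moment 1 &
      2 * (Urev al be)`_2 =
        (n%:R ^+ 2 - n%:R - \sum_(i in S) (i%:R : K) ^+ 2) * moment 0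
        + 2 * al * be * (n%:R - 1) * moment 1 + moment 2].
Proof.
move=> al2 be2; rewrite /moment.
have s1 I : \sum_(i in S) (al + be * signedval K I i) =
    al * n%:R + be * signedsum I.
  by rewrite big_split /= sumr_const mulr_natr mulr_sumr.
have s2 I : \sum_(i in S) (al + be * signedval K I i) ^+ 2 =
    n%:R + 2 * al * be * signedsum I + \sum_(i in S) (i%:R : K) ^+ 2.
  rewrite /signedsum -sumr_const mulr_sumr -!big_split /=; apply: eq_bigr => i _.
  have -> : (i%:R : K) ^+ 2 = signedval K I i ^+ 2.
    by rewrite /signedval; case: ifP => _; ring.
  by rewrite sqrrD exprMn al2 be2; ring.
have P I := prod_1addcX_coefs S (fun i => al + be * signedval K I i).
split.
- rewrite coef_sum; apply: eq_bigr => I _; rewrite coefZ.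
  by have [-> _ _] := P I.
- rewrite coef_sum !mulr_sumr -big_split; apply: eq_bigr => I _; rewrite coefZ.
  by have [_ -> _] := P I; rewrite s1 /=; ring.
- rewrite coef_sum !mulr_sumr -!big_split; apply: eq_bigr => I _.
  rewrite coefZ mulrCA; have [_ _ ->] := P I.
  by rewrite s1 s2 sqrrD !exprMn al2 be2 /=; ring.
Qed.

(** The quantity of [bilinear_vanish] centred at its point of symmetry: the
    argument [t] of [Ugen] is [1 + v]. *)
Definition bilin (v : K) : K :=
  w ^+ 2 * (v ^+ 2 + b) * Ugen m z w a b (1 + v) * Ugen m z w a b (1 - v)
  - z ^+ 2 * (v ^+ 2 + a) * Ugen m z w a b (v - 1) * Ugen m z w a b (- 1 - v).

Lemma bilinN v : bilin (- v) = bilin v.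
Proof.
rewrite /bilin opprK sqrrN.
have -> : - 1 + v = v - 1 by ring.
by have -> : - v - 1 = - 1 - v; ring.
Qed.

Lemma bilin0 i : i \in S -> bilin (i%:R - 1) = 0.
Proof.
move=> iS; apply/eqP; rewrite subr_eq0; apply/eqP.
have := bilinear_vanish z w a b iS; rewrite /shifted.
have -> : 1 + (i%:R - 1) = i%:R :> K by ring.
have -> : 1 - (i%:R - 1) = 2 - i%:R :> K by ring.
have -> : i%:R - 1 - 1 = i%:R - 2 :> K by ring.
have -> : - 1 - (i%:R - 1) = - i%:R :> K by ring.
by rewrite ![_ + _ ^+ 2]addrC => ->; ring.
Qed.

Let E : {poly K} :=
  w ^+ 2 *: ((1 + b *: 'X^2) * (Urev 1 1 * Urev (-1) (-1)))
  - z ^+ 2 *: ((1 + a *: 'X^2) * (Urev (-1) 1 * Urev 1 (-1))).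

Let horner_bilin v : v != 0 -> v ^+ n.*2.+2 * E.[v^-1] = (-1) ^+ n * bilin v.
Proof.
move=> v0.
rewrite /E hornerD hornerN !hornerZ !hornerM !hornerD !hornerZ !hornerXn hornerC.
transitivity
  (w ^+ 2 * (v ^+ 2 + b) * (v ^+ n * (Urev 1 1).[v^-1])
     * (v ^+ n * (Urev (-1) (-1)).[v^-1])
   - z ^+ 2 * (v ^+ 2 + a) * (v ^+ n * (Urev (-1) 1).[v^-1])
     * (v ^+ n * (Urev 1 (-1)).[v^-1])).
  by rewrite -addnn !exprS exprD exprVn; field.
rewrite !horner_Urev1 // !horner_UrevN1 // /bilin.
have -> : - (v - 1) = 1 - v by ring.
have -> : - (v + 1) = -1 - v by ring.
by rewrite [v + 1]addrC; ring.
Qed.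

Let size_bilin : (size E <= n.*2.+3)%N.
Proof.
have sc (c : K) al be ga de :
    (size ((1 + c *: 'X^2) * (Urev al be * Urev ga de))%R <= n.*2.+3)%N.
  rewrite -[n.*2]addnn -[_.+3]/(2 + (n + n)).+1.
  apply: size_mul_bound (size_1addcXn _ _) _.
  by apply: size_mul_bound; exact: size_Urev.
rewrite /E (leq_trans (size_polyD _ _)) // geq_max size_polyN.
by rewrite !(leq_trans (size_scale_leq _ _)) // sc.
Qed.

Let bilin_coefs : w ^+ 2 - z ^+ 2 = 1 ->
  [/\ E`_0 = moment 0 ^+ 2, E`_1 = 0 &
   E`_2 = moment 0 * moment 2 - moment 1 ^+ 2
   - 2 * (z ^+ 2 + w ^+ 2) * moment 0 * moment 1
   + (w ^+ 2 * b - z ^+ 2 * a) * moment 0 ^+ 2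
   - (n%:R + \sum_(i in S) (i%:R : K) ^+ 2) * moment 0 ^+ 2].
Proof.
move=> wz; have w2 : w ^+ 2 = 1 + z ^+ 2 by rewrite -wz subrK.
have m1sq : (-1) ^+ 2 = 1 :> K by rewrite sqrrN expr1n.
have [p0 p1 p2] := Urev_coefs (expr1n K 2) (expr1n K 2).
have [q0 q1 q2] := Urev_coefs m1sq m1sq.
have [r0 r1 r2] := Urev_coefs m1sq (expr1n K 2).
have [s0 s1 s2] := Urev_coefs (expr1n K 2) m1sq.
rewrite /E; split; rewrite coefB !coefZ !coef_1addcX2_mul /=.
- by rewrite !coef0M p0 q0 r0 s0 w2; ring.
- rewrite !coefM !big_ord_recl !big_ord0 /= p0 q0 r0 s0 p1 q1 r1 s1 w2.
  by ring.
- apply: (mulfI (x := 2)); first by rewrite pnatr_eq0.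
  rewrite !coefM !big_ord_recl !big_ord0 /= p0 q0 r0 s0 p1 q1 r1 s1.
  rewrite /bump /= ?add1n ?addn0.
  transitivity
    (w ^+ 2 * (moment 0 * (2 * (Urev 1 1)`_2)
               + moment 0 * (2 * (Urev (-1) (-1))`_2)
               + 2 * (Urev 1 1)`_1 * (Urev (-1) (-1))`_1
               + 2 * b * moment 0 ^+ 2)
     - z ^+ 2 * (moment 0 * (2 * (Urev (-1) 1)`_2)
                 + moment 0 * (2 * (Urev 1 (-1))`_2)
                 + 2 * (Urev (-1) 1)`_1 * (Urev 1 (-1))`_1
                 + 2 * a * moment 0 ^+ 2)).
    by rewrite p1 q1 r1 s1; ring.
  by rewrite p1 q1 r1 s1 p2 q2 r2 s2 w2; ring.
Qed.

(** The bilinear quantity is known from its zeros [v = i - 1] and [v = 1 - i], for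
    [i] in [S], and from its two leading coefficients. *)
Lemma bilin_eq v : v != 0 -> w ^+ 2 - z ^+ 2 = 1 ->
  (-1) ^+ n * bilin v =
  (moment 0 ^+ 2 * v ^+ 2 + (moment 0 * moment 2 - moment 1 ^+ 2)
   - 2 * (z ^+ 2 + w ^+ 2) * moment 0 * moment 1
   + (w ^+ 2 * b - z ^+ 2 * a) * moment 0 ^+ 2
   - 2 * (\sum_(i in S) i%:R) * moment 0 ^+ 2)
  * \prod_(i in S) (v ^+ 2 - (i%:R - 1) ^+ 2).
Proof.
move=> v0 wz; have [E0 E1 E2] := bilin_coefs wz.
have pos1 : {in S, forall i : 'I_(m.*2.+1), 0 < i%:R - 1 :> K}.
  move=> i; rewrite in_evens subr_gt0 => /andP[]; rewrite ltr1n.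
  by case: (nat_of_ord i) => [|[]].
have inj1 : {in S &, injective (fun i : 'I_(m.*2.+1) => i%:R - 1 : K)}.
  by move=> i j _ _ /addIr/eqP; rewrite eqr_nat => /eqP/ord_inj.
have rE : {in S, forall i : 'I_(m.*2.+1),
    root E (i%:R - 1)^-1 /\ root E (- (i%:R - 1)^-1)}.
  move=> i iS; have i0 : i%:R - 1 != 0 :> K by rewrite gt_eqF // pos1.
  split; apply/rootP.
    have := horner_bilin i0; rewrite bilin0 // mulr0 => /eqP.
    by rewrite mulf_eq0 expf_eq0 (negPf i0) andbF /= => /eqP.
  have := @horner_bilin (- (i%:R - 1)).
  rewrite bilinN oppr_eq0 bilin0 // mulr0 invrN => /(_ i0)/eqP.
  by rewrite mulf_eq0 expf_eq0 oppr_eq0 (negPf i0) andbF /= => /eqP.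
rewrite -horner_bilin // (even_interpolation pos1 inj1 size_bilin E1 rE v0) E0 E2.
congr (_ * _).
have -> : \sum_(i in S) (i%:R - 1 : K) ^+ 2 =
   \sum_(i in S) (i%:R : K) ^+ 2 - 2 * (\sum_(i in S) i%:R) + n%:R.
  rewrite -sumr_const mulr_sumr -sumrN -!big_split /=.
  by apply: eq_bigr => i _; ring.
ring.
Qed.

End Bilinear.

(** * Polynomial functions *)

Section PolynomialFunctions.
Variable K : numFieldType.

Definition polyfun (f : K -> K) := exists p : {poly K}, forall x, f x = p.[x].

Lemma polyfun_cst c : polyfun (fun=> c).
Proof. by exists c%:P => x; rewrite hornerC. Qed.

Lemma polyfun_id : polyfun id.
Proof. by exists 'X => x; rewrite hornerX. Qed.

Lemma polyfunD f g : polyfun f -> polyfun g -> polyfun (fun x => f x + g x).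
Proof. by move=> [p pE] [q qE]; exists (p + q) => x; rewrite hornerD pE qE. Qed.

Lemma polyfunM f g : polyfun f -> polyfun g -> polyfun (fun x => f x * g x).
Proof. by move=> [p pE] [q qE]; exists (p * q) => x; rewrite hornerM pE qE. Qed.

Lemma polyfunN f : polyfun f -> polyfun (fun x => - f x).
Proof. by move=> [p pE]; exists (- p) => x; rewrite hornerN pE. Qed.

Lemma polyfunX f k : polyfun f -> polyfun (fun x => f x ^+ k).
Proof. by move=> [p pE]; exists (p ^+ k) => x; rewrite horner_exp pE. Qed.

Lemma polyfun_sum (I : Type) (r : seq I) (P : pred I) (F : I -> K -> K) :
  (forall i, polyfun (F i)) -> polyfun (fun x => \sum_(i <- r | P i) F i x).
Proof.
move=> FP; elim: r => [|i r [p IH]].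
  by exists 0 => x; rewrite big_nil horner0.
have [q qE] := FP i; exists (if P i then q + p else p) => x.
by rewrite big_cons IH qE; case: ifP => //; rewrite hornerD.
Qed.

Lemma polyfun_prod (I : Type) (r : seq I) (P : pred I) (F : I -> K -> K) :
  (forall i, polyfun (F i)) -> polyfun (fun x => \prod_(i <- r | P i) F i x).
Proof.
move=> FP; elim: r => [|i r [p IH]].
  by exists 1 => x; rewrite big_nil hornerC.
have [q qE] := FP i; exists (if P i then q * p else p) => x.
by rewrite big_cons IH qE; case: ifP => //; rewrite hornerM.
Qed.

Lemma poly_horner0 (p : {poly K}) : (forall x, p.[x] = 0) -> p = 0.
Proof.
move=> p0; apply: (@roots_geq_poly_eq0 _ _ [seq k%:R | k <- iota 0 (size p)]).
- by apply/allP => x _; apply/rootP.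
- by rewrite map_inj_uniq ?iota_uniq // => i j /eqP; rewrite eqr_nat => /eqP.
- by rewrite size_map size_iota.
Qed.

Lemma polyfun_generic f g : polyfun f -> polyfun g -> (exists x, g x != 0) ->
  (forall x, g x != 0 -> f x = 0) -> forall x, f x = 0.
Proof.
move=> [p pE] [q qE] [x0 gx0] fg.
have /eqP : p * q = 0.
  apply: poly_horner0 => x; rewrite hornerM -pE -qE.
  by have [->|/fg->] := eqVneq (g x) 0; rewrite ?mulr0 ?mul0r.
rewrite mulf_eq0 => /orP[/eqP p0 x|/eqP q0]; first by rewrite pE p0 horner0.
by move: gx0; rewrite qE q0 horner0 eqxx.
Qed.

End PolynomialFunctions.

(** * The Toda relation between moments *)

Section Toda.
Variables (K : numFieldType) (m : nat).
Local Notation S := (evens m).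
Implicit Types (z w b : K).

(** With [a = -4 c^2], the factor of [a_i] at [l] is [(l - 1 - 2c) (l - 1 + 2c)], so
    that the shift [c -> c + 1] telescopes. *)
Lemma evenprod_shift (c : K) (i : nat) : ~~ odd i ->
  evenprod (- 4 * (c + 1) ^+ 2) i * (1 + 2 * c - i%:R) =
  evenprod (- 4 * c ^+ 2) i * (1 + 2 * c + i%:R).
Proof.
move=> ei; rewrite -(odd_double_half i) (negPf ei) add0n.
elim: (i./2) => [|k IH]; first by rewrite double0 !evenprod0; ring.
rewrite doubleS !evenprodSS ?odd_double // /shifted.
rewrite -[k.*2.+2]addn2 natrD.
set A := evenprod _ _ in IH *; set B := evenprod _ _ in IH *.
set x := (k.*2)%:R in IH *.
transitivity (A * (1 + 2 * c - x) * ((x + 3 + 2 * c) * (x + 1 - 2 * c))).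
  by ring.
by rewrite IH; ring.
Qed.

(** In soliton language, raising [c] is the vertex operator with parameter
    [1 + 2 c], and [Ugen] is the generating function of all vertex operators. *)
Lemma Ugen_raise z w b c :
  Ugen m z w (- 4 * c ^+ 2) b (1 + 2 * c) =
  U0 m z w (- 4 * (c + 1) ^+ 2) b * \prod_(i in S) (1 + 2 * c - i%:R).
Proof.
rewrite U0E mulr_suml; apply: eq_bigr => I sI.
have E (F : 'I_(m.*2.+1) -> K) : \prod_(i in S) F i =
    (\prod_(i in I) F i) * \prod_(i in S :\: I) F i.
  by rewrite (big_setID I) /= (setIidPr sI).
rewrite !E /Uterm.
have -> : \prod_(i in S :\: I) (1 + 2 * c + signedval K I i) =
    \prod_(i in S :\: I) (1 + 2 * c - i%:R).
  by apply: eq_bigr => i; rewrite /signedval inE => /andP[/negPf->].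
have H : evenprodset (- 4 * c ^+ 2) I
      * \prod_(i in I) (1 + 2 * c + signedval K I i) =
    evenprodset (- 4 * (c + 1) ^+ 2) I * \prod_(i in I) (1 + 2 * c - i%:R).
  rewrite /evenprodset -!big_split /=; apply: eq_bigr => i iI.
  rewrite evenprod_shift /signedval ?iI //.
  by have := subsetP sI i iI; rewrite in_evens => /andP[].
set P1 := \prod_(i in I) _ in H *; set P2 := \prod_(i in I) _ in H *.
transitivity ((\prod_(i in I) \prod_(j in S :\: I) pairweight K i j) *
   (-1) ^+ (sumset I)./2 * evenprodset b (S :\: I) * z ^+ sumset I *
   w ^+ sumset (S :\: I) * (evenprodset (- 4 * c ^+ 2) I * P1) *
   \prod_(i in S :\: I) (1 + 2 * c - i%:R)); first by ring.
by rewrite H; ring.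
Qed.

Lemma Ugen_lower z w b c :
  Ugen m z w (- 4 * c ^+ 2) b (1 - 2 * c) =
  U0 m z w (- 4 * (c - 1) ^+ 2) b * \prod_(i in S) (1 - 2 * c - i%:R).
Proof.
have := Ugen_raise z w b (- c).
have -> : - c + 1 = - (c - 1) by ring.
by rewrite !sqrrN mulrN.
Qed.

Lemma polyfun_Uterm z w b (I : {set 'I_(m.*2.+1)}) (f : K -> K) : polyfun f ->
  polyfun (fun c => Uterm z w (- 4 * f c ^+ 2) b I).
Proof.
move=> pf; rewrite /Uterm /evenprodset /evenprod /shifted.
do 3 (apply: polyfunM; last exact: polyfun_cst).
apply: polyfunM; first exact: polyfun_cst.
apply: polyfun_prod => i; apply: polyfun_prod => l.
apply: polyfunD; last exact: polyfun_cst.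
by apply: polyfunM; [exact: polyfun_cst|exact: polyfunX].
Qed.

Lemma polyfun_moment z w b k :
  polyfun (fun c => moment m z w (- 4 * c ^+ 2) b k).
Proof.
apply: polyfun_sum => I; apply: polyfunM; last exact: polyfun_cst.
exact: polyfun_Uterm (@polyfun_id K).
Qed.

Lemma polyfun_U0 z w b (f : K -> K) : polyfun f ->
  polyfun (fun c => U0 m z w (- 4 * f c ^+ 2) b).
Proof. by move=> pf; apply: polyfun_sum => I; apply: polyfun_Uterm. Qed.

(** [bilin_eq] at [v = 2 b1]: then [v^2 + a = 0] and [v^2 + b = 4 (b1^2 - b2^2)].
    The factors [1 + 2 b1 - i] and [1 - 2 b1 - i] left by [Ugen_raise] and
    [Ugen_lower] are those of the product over [S] in [bilin_eq]; cancelling them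
    needs [b1] generic, which suffices. *)
Lemma toda_moments z w (b1 b2 : K) : w ^+ 2 - z ^+ 2 = 1 ->
  let M := moment m z w (- 4 * b1 ^+ 2) (- 4 * b2 ^+ 2) in
  let U c := U0 m z w (- 4 * c ^+ 2) (- 4 * b2 ^+ 2) in
  4 * (b1 ^+ 2 - b2 ^+ 2) * w ^+ 2 * (U (b1 - 1) * U (b1 + 1)) =
  4 * (b1 ^+ 2 - b2 ^+ 2) * w ^+ 2 * M 0%N ^+ 2
  + (M 0%N * M 2 - M 1%N ^+ 2)
  - 2 * (z ^+ 2 + w ^+ 2) * M 0%N * M 1%N
  - 2 * (\sum_(i in S) i%:R) * M 0%N ^+ 2.
Proof.
move=> wz M U; rewrite {}/M {}/U.
apply/eqP; rewrite -subr_eq0; apply/eqP; move: b1.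
apply: (@polyfun_generic _ _
  (fun c => c * \prod_(i in S) ((2 * c) ^+ 2 - (i%:R - 1) ^+ 2))).
- by repeat first [exact: polyfun_cst | exact: polyfun_id
    | exact: polyfun_moment
    | apply: (@polyfun_U0 z w (- 4 * b2 ^+ 2) (fun c => c + 1))
    | apply: (@polyfun_U0 z w (- 4 * b2 ^+ 2) (fun c => c - 1))
    | apply: polyfunD | apply: polyfunM | apply: polyfunN | apply: polyfunX].
- apply: polyfunM; first exact: polyfun_id.
  apply: polyfun_prod => i; apply: polyfunD; last exact: polyfun_cst.
  by apply: polyfunX; apply: polyfunM; [exact: polyfun_cst|exact: polyfun_id].
- (* At [c = m + 1], [2 c] exceeds every [i - 1]. *)
  exists m.+1%:R; rewrite mulf_neq0 ?pnatr_eq0 //; apply/prodf_neq0 => i iS.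
  have E2 : 2 * m.+1%:R = (m.*2.+2)%:R :> K by rewrite -natrM; congr _%:R; lia.
  have lt1 : i%:R - 1 < 2 * m.+1%:R :> K.
    rewrite ltrBlDr E2 natr1 ltr_nat.
    by have := ltn_ord i; lia.
  have gt1 : 0 < 2 * m.+1%:R + (i%:R - 1) :> K.
    by rewrite addrA subr_gt0 E2 -natrD ltr1n; lia.
  by rewrite subr_sqr mulf_neq0 // gt_eqF // subr_gt0.
move=> c; rewrite mulf_eq0 negb_or => /andP[c0 P0].
have v0 : 2 * c != 0 by rewrite mulf_neq0 ?pnatr_eq0.
have := bilin_eq m (- 4 * c ^+ 2) (- 4 * b2 ^+ 2) v0 wz.
rewrite /bilin Ugen_raise Ugen_lower.
have w2 : w ^+ 2 = 1 + z ^+ 2 by rewrite -wz subrK.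
set Pr := \prod_(i in S) ((2 * c) ^+ 2 - _) in P0 *.
have EP : \prod_(i in S) (1 + 2 * c - i%:R) * \prod_(i in S) (1 - 2 * c - i%:R) =
    (-1) ^+ #|S| * Pr :> K.
  by rewrite /Pr -prodr_const -!big_split /=; apply: eq_bigr => i _; ring.
set P1 := \prod_(i in S) _ in EP *; set P2 := \prod_(i in S) _ in EP *.
set e := (-1) ^+ #|S| in EP *.
have ee : e * e = 1 by rewrite /e -exprD addnn -mul2n exprM sqrrN !expr1n.
set Up := U0 _ _ _ _ _; set Um := U0 _ _ _ _ _ => H.
apply: (mulIf P0); rewrite mul0r.
set M0 := moment _ _ _ _ _ 0 in H *.
set M1 := moment _ _ _ _ _ 1 in H *.
set M2 := moment _ _ _ _ _ 2 in H *.
set sg := \sum_(i in S) _ in H *.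
rewrite mulrBl; apply/eqP; rewrite subr_eq0; apply/eqP.
transitivity (e * (w ^+ 2 * (4 * (c ^+ 2 - b2 ^+ 2)) * Up * Um * (P1 * P2))).
  rewrite EP.
  transitivity ((e * e) * (4 * (c ^+ 2 - b2 ^+ 2) * w ^+ 2 * (Up * Um) * Pr)).
    by rewrite ee; ring.
  by ring.
transitivity ((M0 ^+ 2 * (2 * c) ^+ 2 + (M0 * M2 - M1 ^+ 2) -
      2 * (z ^+ 2 + w ^+ 2) * M0 * M1 +
      (w ^+ 2 * (- 4 * b2 ^+ 2) - z ^+ 2 * (- 4 * c ^+ 2)) * M0 ^+ 2 -
      2 * sg * M0 ^+ 2) * Pr); last by rewrite w2; ring.
by rewrite -H; ring.
Qed.

End Toda.

(** * Derivatives of vector-valued sums *)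

Section VectorDerivative.
Local Open Scope classical_set_scope.
Variables (R : realType) (V : normedModType R).

Lemma is_derive_scalel (f : R -> R) (k : V) (x v df : R) :
  is_derive x v f df -> is_derive x v (fun y => f y *: k) (df *: k).
Proof.
move=> [fx fE].
have c : (fun h => h^-1 *: (((fun y => f y *: k) \o shift x) (h *: v)
                            - f x *: k)) @ 0^' --> df *: k.
  rewrite (_ : (fun h => _) =
    fun h => (h^-1 *: ((f \o shift x) (h *: v) - f x)) *: k).
    by apply: cvgZr_tmp; rewrite -fE; exact: fx.
  by apply/funext => h /=; rewrite -scalerBl scalerA.
by apply: DeriveDef; [apply/cvg_ex; exists (df *: k)|exact: cvg_lim c].
Qed.

Lemma is_derive_bigsum (I : Type) (r : seq I) (P : pred I) (f : I -> R -> V)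
    (df : I -> V) (x v : R) :
  (forall i, is_derive x v (f i) (df i)) ->
  is_derive x v (fun y => \sum_(i <- r | P i) f i y) (\sum_(i <- r | P i) df i).
Proof.
move=> fP; elim: r => [|i r IH].
  rewrite big_nil (_ : (fun _ => _) = cst 0); first exact: is_derive_cst.
  by apply/funext => y; rewrite big_nil.
rewrite big_cons; case: ifP => Pi; last first.
  by under eq_fun do rewrite big_cons Pi.
under eq_fun do rewrite big_cons Pi.
exact: (is_deriveD (fP i) IH).
Qed.

End VectorDerivative.

(** * Hyperbolic functions of the half argument *)

Section Hyperbolic.
Variable R : realType.
Implicit Types (x : R) (p q : nat).

Definition shalf x : R := 2^-1 * (expR (2^-1 * x) - expR (- (2^-1 * x))).
Definition chalf x : R := 2^-1 * (expR (2^-1 * x) + expR (- (2^-1 * x))).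

Lemma chalf2_shalf2 x : chalf x ^+ 2 - shalf x ^+ 2 = 1.
Proof.
rewrite /chalf /shalf.
have E : expR (2^-1 * x) * expR (- (2^-1 * x)) = 1 by rewrite -expRD subrr expR0.
set s := expR _ in E *; set t := expR _ in E *.
by transitivity (s * t); [field|].
Qed.

Lemma chalf_gt0 x : 0 < chalf x.
Proof. by rewrite mulr_gt0 ?invr_gt0 // addr_gt0 // expR_gt0. Qed.

Lemma shalf_gt0 x : 0 < x -> 0 < shalf x.
Proof. by move=> x0; rewrite mulr_gt0 ?invr_gt0 // subr_gt0 ltr_expR; lra. Qed.

Lemma expR_double x : expR x = expR (2^-1 * x) ^+ 2.
Proof. by rewrite expr2 -expRD; congr expR; field. Qed.

Lemma zfunE x : 0 < x -> zfun x = shalf x.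
Proof.
move=> x0; rewrite /zfun expR_double [expR (- x)]expR_double mulrN.
have E : expR (2^-1 * x) * expR (- (2^-1 * x)) = 1 by rewrite -expRD subrr expR0.
have := shalf_gt0 x0; rewrite /shalf pmulr_rgt0 ?invr_gt0 // => h.
congr (_ * _); rewrite -[RHS](ger0_norm (ltW h)) -sqrtr_sqr; congr Num.sqrt.
by rewrite sqrrB E; ring.
Qed.

Lemma wfunE x : wfun x = chalf x.
Proof.
rewrite /wfun expR_double [expR (- x)]expR_double mulrN.
have E : expR (2^-1 * x) * expR (- (2^-1 * x)) = 1 by rewrite -expRD subrr expR0.
have := chalf_gt0 x; rewrite /chalf pmulr_rgt0 ?invr_gt0 // => h.
congr (_ * _); rewrite -[RHS](ger0_norm (ltW h)) -sqrtr_sqr; congr Num.sqrt.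
by rewrite sqrrD E; ring.
Qed.

Lemma is_derive_expRM (c x : R) :
  is_derive x 1 (fun y => expR (c * y)) (c * expR (c * x)).
Proof.
have h : is_derive x 1 (c \*: (id : R -> R)) (c *: 1) by exact: is_deriveZ.
have := @is_derive1_comp _ expR _ x _ _ (is_derive_expR _) h.
by move/is_derive_eq; apply; rewrite /GRing.scale /= mulr1 mulrC.
Qed.

Lemma is_derive_shalf x : is_derive x 1 shalf (2^-1 * chalf x).
Proof.
rewrite (_ : shalf = 2^-1 \*: ((fun y => expR (2^-1 * y))
                               - (fun y => expR (- 2^-1 * y)))).
  have := is_deriveZ 2^-1 (is_deriveB (is_derive_expRM 2^-1 x)
                                      (is_derive_expRM (- 2^-1) x)).
  move/is_derive_eq; apply.
  by rewrite /GRing.scale /= /chalf !mulNr; ring.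
by apply/funext => y; rewrite /shalf -mulNr.
Qed.

Lemma is_derive_chalf x : is_derive x 1 chalf (2^-1 * shalf x).
Proof.
rewrite (_ : chalf = 2^-1 \*: ((fun y => expR (2^-1 * y))
                               + (fun y => expR (- 2^-1 * y)))).
  have := is_deriveZ 2^-1 (is_deriveD (is_derive_expRM 2^-1 x)
                                      (is_derive_expRM (- 2^-1) x)).
  move/is_derive_eq; apply.
  by rewrite /GRing.scale /= /shalf !mulNr; ring.
by apply/funext => y; rewrite /chalf -mulNr.
Qed.

(** The derivatives of a monomial in [shalf] and [chalf] are again combinations of
    monomials; [q.-1] and [p.-1] only occur with a zero coefficient when they are
    truncated. *)
Definition hmono p q x : R := shalf x ^+ p * chalf x ^+ q.
Definition dhmono p q x : R :=
  2^-1 * (p%:R * hmono p.-1 q.+1 x + q%:R * hmono p.+1 q.-1 x).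
Definition ddhmono p q x : R :=
  2^-1 * (p%:R * dhmono p.-1 q.+1 x + q%:R * dhmono p.+1 q.-1 x).

Lemma is_derive_hmono p q x : is_derive x 1 (hmono p q) (dhmono p q x).
Proof.
rewrite (_ : hmono p q = shalf ^+ p * chalf ^+ q); last first.
  by apply/funext => y; rewrite /hmono mulrfctE !exprfctE.
have := is_deriveM (is_deriveX p (is_derive_shalf x))
                   (is_deriveX q (is_derive_chalf x)).
move/is_derive_eq; apply.
rewrite /dhmono /hmono /GRing.scale /= !exprfctE !exprS; ring.
Qed.

Lemma is_derive_dhmono p q x : is_derive x 1 (dhmono p q) (ddhmono p q x).
Proof.
rewrite (_ : dhmono p q =
  2^-1 \*: (p%:R \*: hmono p.-1 q.+1 + q%:R \*: hmono p.+1 q.-1)); last first.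
  by apply/funext.
exact: (is_deriveZ 2^-1
  (is_deriveD (is_deriveZ p%:R (is_derive_hmono p.-1 q.+1 x))
              (is_deriveZ q%:R (is_derive_hmono p.+1 q.-1 x)))).
Qed.

Lemma dhmonoE p q x :
  2 * (shalf x * chalf x) * dhmono p q x =
  (p%:R * chalf x ^+ 2 + q%:R * shalf x ^+ 2) * hmono p q x.
Proof.
rewrite /dhmono /hmono.
by case: p => [|p]; case: q => [|q] /=; rewrite !exprS; field.
Qed.

Lemma ddhmonoE p q x :
  4 * (shalf x * chalf x) ^+ 2 * ddhmono p q x =
  ((p%:R * chalf x ^+ 2 + q%:R * shalf x ^+ 2) ^+ 2
   + 2 * (p + q)%:R * (shalf x * chalf x) ^+ 2
   - (p%:R * chalf x ^+ 2 + q%:R * shalf x ^+ 2)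
     * (shalf x ^+ 2 + chalf x ^+ 2)) * hmono p q x.
Proof.
rewrite /ddhmono.
set s := shalf x; set c := chalf x.
transitivity (s * c * (p%:R * (2 * (s * c) * dhmono p.-1 q.+1 x)
                       + q%:R * (2 * (s * c) * dhmono p.+1 q.-1 x))).
  by field.
rewrite !dhmonoE /hmono -/s -/c natrD.
case: p => [|p]; case: q => [|q] /=; rewrite !exprS -?natr1; ring.
Qed.

End Hyperbolic.

(** * Derivatives of the Umemura polynomials *)

Section UmemuraDerivatives.
Variables (R : realType) (m : nat).
Local Notation S := (evens m).
Implicit Types I : {set 'I_(m.*2.+1)}.

Lemma scaleRcE (r : R) (c : Rcomplex R) : r *: c = r%:C * c :> R[i].
Proof. by case: c => u v; simpc; rewrite /GRing.scale /=. Qed.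

Definition ucoef (a b : R[i]) I : R[i] :=
  (\prod_(i in I) \prod_(j in S :\: I) pairweight R[i] i j)
    * (-1) ^+ (sumset I)./2 * evenprodset a I * evenprodset b (S :\: I).

Lemma UtermE (a b : R[i]) I (x : R) :
  Uterm (shalf x)%:C (chalf x)%:C a b I =
  (hmono (sumset I) (sumset (S :\: I)) x)%:C * ucoef a b I.
Proof.
rewrite /Uterm /ucoef /hmono; move: (shalf x) (chalf x) => s c.
by rewrite rmorphM !rmorphXn /=; ring.
Qed.

Lemma dhmonoEC p q (x : R) : let z := (shalf x)%:C in let w := (chalf x)%:C in
  2 * (z * w) * (dhmono p q x)%:C =
  (p%:R * w ^+ 2 + q%:R * z ^+ 2) * (hmono p q x)%:C.
Proof.
move=> z w; have := congr1 (real_complex R) (dhmonoE p q x).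
rewrite {}/z {}/w.
move: (shalf x) (chalf x) (hmono p q x) (dhmono p q x) => s c h d.
by rewrite !(rmorphM, rmorphD, rmorphXn, rmorph_nat).
Qed.

Lemma ddhmonoEC p q (x : R) : let z := (shalf x)%:C in let w := (chalf x)%:C in
  4 * (z * w) ^+ 2 * (ddhmono p q x)%:C =
  ((p%:R * w ^+ 2 + q%:R * z ^+ 2) ^+ 2 + 2 * (p + q)%:R * (z * w) ^+ 2
   - (p%:R * w ^+ 2 + q%:R * z ^+ 2) * (z ^+ 2 + w ^+ 2)) * (hmono p q x)%:C.
Proof.
move=> z w; have := congr1 (real_complex R) (ddhmonoE p q x).
rewrite {}/z {}/w.
move: (shalf x) (chalf x) (hmono p q x) (ddhmono p q x) => s c h d.
by rewrite !(rmorphM, rmorphB, rmorphD, rmorphXn, rmorph_nat).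
Qed.

(** The Umemura polynomial with its monomials in [z] and [w] replaced by [f]; its
    derivatives arise by differentiating [f]. *)
Definition expansion (f : nat -> nat -> R -> R) (a b : R[i]) (x : R) :
    Rcomplex R :=
  \sum_(I : {set 'I_(m.*2.+1)} | I \subset S)
     f (sumset I) (sumset (S :\: I)) x *: (ucoef a b I : Rcomplex R).

Lemma expansionE f a b x :
  expansion f a b x = \sum_(I : {set 'I_(m.*2.+1)} | I \subset S)
     (f (sumset I) (sumset (S :\: I)) x)%:C * ucoef a b I :> R[i].
Proof. by apply: eq_bigr => I _; rewrite scaleRcE. Qed.

Lemma umemuraE b1 b2 x : 0 < x ->
  umemura m b1 b2 x = expansion (@hmono R) (- 4 * b1 ^+ 2) (- 4 * b2 ^+ 2) x.
Proof.
move=> x0; rewrite expansionE /umemura zfunE // wfunE U0E.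
by apply: eq_bigr => I _; rewrite UtermE.
Qed.

Lemma is_derive_expansion (f df : nat -> nat -> R -> R) a b (x : R) :
  (forall p q, is_derive x 1 (f p q) (df p q x)) ->
  is_derive x 1 (expansion f a b) (expansion df a b x).
Proof. by move=> H; apply: is_derive_bigsum => I; exact: is_derive_scalel. Qed.

Lemma cderive1_umemura b1 b2 x : 0 < x ->
  cderive 1 (umemura m b1 b2) x =
  expansion (@dhmono R) (- 4 * b1 ^+ 2) (- 4 * b2 ^+ 2) x.
Proof.
move=> x0; rewrite /cderive derive1n1 derive1E.
have d := is_derive_expansion (- 4 * b1 ^+ 2) (- 4 * b2 ^+ 2)
  (fun p q => is_derive_hmono p q x).
refine (@derive_val _ _ _ _ _ _ _ (near_eq_is_derive _ d)).
by near=> y; symmetry; apply: umemuraE; near: y; exact: lt_nbhsr.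
Unshelve. all: by end_near. Qed.

Lemma cderive2_umemura b1 b2 x : 0 < x ->
  cderive 2 (umemura m b1 b2) x =
  expansion (@ddhmono R) (- 4 * b1 ^+ 2) (- 4 * b2 ^+ 2) x.
Proof.
move=> x0; rewrite /cderive derive1nS derive1E.
have d := is_derive_expansion (- 4 * b1 ^+ 2) (- 4 * b2 ^+ 2)
  (fun p q => is_derive_dhmono p q x).
refine (@derive_val _ _ _ _ _ _ _ (near_eq_is_derive _ d)).
by near=> y; symmetry; apply: cderive1_umemura; near: y; exact: lt_nbhsr.
Unshelve. all: by end_near. Qed.

Lemma sumset_signedsum I : I \subset S ->
  (sumset I)%:R = 2^-1 * (\sum_(i in S) i%:R + signedsum R[i] I) /\
  (sumset (S :\: I))%:R = 2^-1 * (\sum_(i in S) i%:R - signedsum R[i] I) :> R[i].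
Proof.
move=> sI.
have E (F : 'I_(m.*2.+1) -> R[i]) : \sum_(i in S) F i =
    \sum_(i in I) F i + \sum_(i in S :\: I) F i.
  by rewrite (big_setID I) /= (setIidPr sI).
have -> : signedsum R[i] I = (sumset I)%:R - (sumset (S :\: I))%:R.
  rewrite /signedsum E /sumset !natr_sum; congr (_ + _).
    by apply: eq_bigr => i iI; rewrite /signedval iI.
  rewrite -sumrN; apply: eq_bigr => i.
  by rewrite /signedval inE => /andP[/negPf->].
by rewrite E /sumset !natr_sum; split; field.
Qed.

Section Moments.
Variables (b1 b2 : R[i]) (x : R).
Hypothesis x_gt0 : 0 < x.
Let z := (shalf x)%:C.
Let w := (chalf x)%:C.
Local Notation M k := (moment m z w (- 4 * b1 ^+ 2) (- 4 * b2 ^+ 2) k).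

Lemma umemura_U0 (c : R[i]) :
  umemura m c b2 x = U0 m z w (- 4 * c ^+ 2) (- 4 * b2 ^+ 2).
Proof. by rewrite /z /w -wfunE -zfunE. Qed.

Lemma umemura_moment : umemura m b1 b2 x = M 0%N.
Proof.
by rewrite umemura_U0 U0E; apply: eq_bigr => I _; rewrite expr0 mulr1.
Qed.

Let w2 : w ^+ 2 = 1 + z ^+ 2.
Proof.
apply/eqP; rewrite -subr_eq; apply/eqP.
by rewrite /w /z -!rmorphXn -rmorphB /= chalf2_shalf2.
Qed.

(** The logarithmic derivative of [z^p w^q] is [(p w^2 + q z^2) / (2 z w)].  For
    [p = sumset I] and [q] its complement this is, since [w^2 - z^2 = 1], affine in
    [p - q = signedsum I], with a constant term that involves only
    [p + q = \sum_(i in S) i]. *)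
Lemma cderive1_moments (sg := \sum_(i in S) i%:R) :
  2 * (z * w) * cderive 1 (umemura m b1 b2) x =
  2^-1 * (M 1%N + sg * (z ^+ 2 + w ^+ 2) * M 0%N).
Proof.
rewrite cderive1_umemura // expansionE -umemura_moment umemura_U0 U0E /moment.
rewrite !mulr_sumr -big_split mulr_sumr.
apply: eq_bigr => I sI /=; rewrite UtermE mulrA dhmonoEC -/z -/w.
have [-> ->] := sumset_signedsum sI; rewrite -/sg expr1.
by move: sg => sg; rewrite w2; field.
Qed.

Lemma cderive2_moments (sg := \sum_(i in S) i%:R) :
  4 * (z * w) ^+ 2 * cderive 2 (umemura m b1 b2) x =
  4^-1 * (M 2 + 2 * sg * (z ^+ 2 + w ^+ 2) * M 1%N
          + sg ^+ 2 * (z ^+ 2 + w ^+ 2) ^+ 2 * M 0%N)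
  + 2 * sg * (z * w) ^+ 2 * M 0%N
  - 2^-1 * (z ^+ 2 + w ^+ 2) * (M 1%N + sg * (z ^+ 2 + w ^+ 2) * M 0%N).
Proof.
move sgE : sg => s.
rewrite cderive2_umemura // expansionE -umemura_moment umemura_U0 U0E /moment.
rewrite !mulr_sumr -!big_split !mulr_sumr -sumrN -!big_split.
apply: eq_bigr => I sI /=; rewrite UtermE mulrA ddhmonoEC -/z -/w natrD.
have [-> ->] := sumset_signedsum sI; rewrite -/sg sgE expr1.
by rewrite !exprMn w2; field.
Qed.

End Moments.

End UmemuraDerivatives.

(** * The Toda equation *)

Theorem theorem2 (R : realType) (m : nat) (b1 b2 : R[i]) (x : R) (hx : 0 < x) :
  (b1 ^+ 2 - b2 ^+ 2) * (umemura m (b1 - 1) b2 x * umemura m (b1 + 1) b2 x) =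
  (b1 ^+ 2 - b2 ^+ 2) * umemura m b1 b2 x ^+ 2
  + 2 * (zfun x)%:C ^+ 2 * hirota2 (umemura m b1 b2) (umemura m b1 b2) x.
Proof.
pose z := (shalf x)%:C; pose w := (chalf x)%:C.
have w0 : w != 0 by rewrite /w eq_complex /= gt_eqF // chalf_gt0.
have wz : w ^+ 2 - z ^+ 2 = 1.
  by rewrite /w /z -!rmorphXn -rmorphB /= chalf2_shalf2.
have f0 : 4 * w ^+ 2 != 0 by rewrite mulf_neq0 ?pnatr_eq0 // expf_neq0.
have := toda_moments m b1 b2 wz => /=.
have := cderive2_moments m b1 b2 hx; have := cderive1_moments m b1 b2 hx.
rewrite /hirota2 zfunE // -/z -/w.
rewrite (umemura_moment m b1 b2 hx) (umemura_U0 m b2 hx (b1 - 1)).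
rewrite (umemura_U0 m b2 hx (b1 + 1)) -/z -/w.
move: (cderive 1 _ _) (cderive 2 _ _) (U0 _ _ _ (- 4 * (b1 - 1) ^+ 2) _)
  (U0 _ _ _ (- 4 * (b1 + 1) ^+ 2) _) (moment _ _ _ _ _ 0) (moment _ _ _ _ _ 1)
  (moment _ _ _ _ _ 2) (\sum_(i in _) _) => D1 D2 Um Up M0 M1 M2 sg D1E D2E T.
apply: (mulfI f0).
transitivity (4 * (b1 ^+ 2 - b2 ^+ 2) * w ^+ 2 * (Um * Up)); first by ring.
rewrite T.
transitivity (4 * (b1 ^+ 2 - b2 ^+ 2) * w ^+ 2 * M0 ^+ 2 +
   (4 * (4 * (z * w) ^+ 2 * D2) * M0 - 4 * (2 * (z * w) * D1) ^+ 2)); last by ring.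
have w2 : w ^+ 2 = 1 + z ^+ 2 by rewrite -wz subrK.
by rewrite D1E D2E !exprMn w2; field.
Qed.
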